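(* Let $v\in\mathbb{N}\setminus\{1\}$ and let $h\colon\mathbb{N}_2\to\mathbb{C}$ be a $v$-transitive convex light weight such that $v\in V(h)$. Suppose that $E_{h,v}(1)_1$, $C_{h,v}(1)_1$, $B_{h,v}(1)_1$ and $B_h(1)_1$ exist. Then $$\lim_{n\to\infty}a_n^{h,v}\in\mathrm{sqrt}\Big(1-\frac{B_{h,v}(1)_1}{B_h(1)_1}\Big)\subset\mathbb{C},$$ where if $B_h(1)_1=0$ then also $B_{h,v}(1)_1=0$, the quotient $\frac00$ is interpreted as $1$, and the limit is zero.
   Context: $\mathbb{N}=\{1,2,\dots\}$, $\mathbb{N}_0=\{0,1,2,\dots\}$, and $\mathbb{N}_2=\{e\subset\mathbb{N}:|e|=2\}$. A weight is a map $h\colon\mathbb{N}_2\to\mathbb{C}$. A walk of length $n\in\mathbb{N}_0$ is a tuple $w=\langle v_0,\dots,v_n\rangle$ of elements of $\mathbb{N}$ with $v_{i-1}\ne v_i$ for $i=1,\dots,n$; its weight is $h(w)=\prod_{i=1}^n h(\{v_{i-1},v_i\})$ (and $h(w)=1$ if $n=0$). A series $\sum_{x\in X}g(x)$ over an at most countable set $X$ converges absolutely if the sums $\sum_{x\in Y}|g(x)|$ over finite $Y\subset X$ are bounded. For a set $W$ of walks, $h(W)$ denotes the sum of $\sum_{w\in W}h(w)$ when it converges absolutely. $W(n)$ is the set of walks of length $n$ with $v_0=1$. The weight $h$ is light if $\sum_{w\in W(n)}h(w)$ converges absolutely for every $n\in\mathbb{N}_0$. $V(h)$ is the set of vertices $u\in\mathbb{N}$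 such that some walk starting at $1$ and ending at $u$ has nonzero weight. A light weight $h$ is convex if for every $u\in V(h)$, $\sum_{w\in\mathbb{N}\setminus\{u\}}h(\{u,w\})=1$. For $v\in\mathbb{N}\setminus\{1\}$, $h$ is $v$-transitive if there is a bijection $f\colon\mathbb{N}\to\mathbb{N}$ with $f(1)=v$ and $h(\{f(a),f(b)\})=h(\{a,b\})$ for all $\{a,b\}\in\mathbb{N}_2$. Let $a_n^{h,v}=h(W(v,n))$, where $W(v,n)$ is the set of walks in $W(n)$ visiting $v$. Define in $\mathbb{C}[[x]]$ (coefficient of $x^n$ given): $B_h$: weight of walks of length $n$ with $v_0=v_n=1$; $B_{h,v}$: weight of walks of length $n$ with $v_0=v_n=1$ and $v_i\ne v$ for all $i$; $C_{h,v}$: weight of walks of length $n$ with $v_0=1$, $v_n=v$, $v_i\ne v$ for $i<n$; $E_{h,v}$: weight of walks of length $n$ with $v_0=1$, $v_n=v$ and $v_i\notin\{1,v\}$ for $0<i<n$. For $U(x)=\sum_{n\ge0}u_nx^n\in\mathbb{C}[[x]]$, we say $U(1)_1$ exists if $\lim_{n\to\infty}\sum_{j=0}^nu_j$ exists in $\mathbb{C}$, and $U(1)_1$ denotes this limit. For $z\in\mathbb{C}$, $\mathrm{sqrt}(z)=\{\alpha\in\mathbb{C}:\alpha^2=z\}$. *)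

(* Defs.v *)
From HB Require Import structures.
From mathcomp Require Import all_boot all_order all_algebra finmap complex.
From mathcomp Require Import all_classical all_reals all_analysis.
From mathcomp.analysis.showcase Require summability.

Set Implicit Arguments.
Unset Strict Implicit.
Unset Printing Implicit Defensive.

Import Order.TTheory GRing.Theory Num.Theory numFieldNormedType.Exports.

Local Open Scope ring_scope.
Local Open Scope classical_set_scope.
Local Open Scope complex_scope.

(* The vertex set is {1, 2, ...}.  Complex numbers are taken in [R[i]^o], the
   alias of [R[i]] that carries the topology of the modulus. *)
Notation posn := {n : nat | (0 < n)%N}.

Definition vertex1 : posn := exist _ 1%N isT.

Notation pair_set := {e : {fset posn} | #|` e | == 2%N}.

Definition weight (R : realType) : Type := pair_set -> R[i]^o.

(* [edge h a b] is h({a, b}); for a = b, when {a, b} is not in the domain of h,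
   it is the dummy value 0: consecutive vertices of a walk are distinct. *)
Definition edge (R : realType) (h : weight R) (a b : posn) : R[i]^o :=
  if (insub [fset a; b]%fset : option pair_set) is Some e then h e else 0.

Definition abs_cvg (R : realType) (X : choiceType) (D : set X)
    (g : X -> R[i]^o) : Prop :=
  exists M : R, forall Y : {fset X}, [set` Y] `<=` D ->
    \sum_(x <- Y) `|g x : R[i]| <= M%:C.

(* Sum over D as the limit of the finite partial sums, along the finite sets
   ordered by inclusion; it is meaningful only when [abs_cvg D g] holds. *)
Definition sum_on (R : realType) (X : choiceType) (D : set X)
    (g : X -> R[i]^o) : R[i]^o :=
  summability.sum (fun x => if x \in D then g x else 0).

(* The walk <v_0, ..., v_n> is the sequence of its n + 1 vertices. *)
Definition vtx (w : seq posn) (i : nat) : posn := nth vertex1 w i.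

Definition walk (n : nat) (w : seq posn) : Prop :=
  size w = n.+1 /\ forall i, (i < n)%N -> vtx w i != vtx w i.+1.

Definition walk_weight (R : realType) (h : weight R) (w : seq posn) : R[i]^o :=
  \prod_(i < (size w).-1) edge h (vtx w i) (vtx w i.+1).

Definition weight_of (R : realType) (h : weight R) (W : set (seq posn)) :
    R[i]^o :=
  sum_on W (walk_weight h).

Definition walks_from1 (n : nat) : set (seq posn) :=
  [set w | walk n w /\ vtx w 0 = vertex1].

Definition light (R : realType) (h : weight R) : Prop :=
  forall n, abs_cvg (walks_from1 n) (walk_weight h).

Definition reached (R : realType) (h : weight R) : set posn :=
  [set u | exists n w,
    [/\ walk n w, vtx w 0 = vertex1, vtx w n = u & walk_weight h w != 0]].

(* The sums below converge absolutely because h is light and u is reached. *)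
Definition convex_light (R : realType) (h : weight R) : Prop :=
  light h /\
  forall u, reached h u -> sum_on [set w | w != u] (fun w => edge h u w) = 1.

Definition transitive_at (R : realType) (v : posn) (h : weight R) : Prop :=
  exists f : posn -> posn,
    [/\ bijective f, f vertex1 = v &
        forall a b, a != b -> edge h (f a) (f b) = edge h a b].

Definition visit_seq (R : realType) (h : weight R) (v : posn) : (R[i]^o)^nat :=
  fun n => weight_of h [set w | walks_from1 n w /\ v \in w].

(* A power series is given by its sequence of coefficients. *)
Definition B_ (R : realType) (h : weight R) : (R[i]^o)^nat :=
  fun n => weight_of h [set w | walks_from1 n w /\ vtx w n = vertex1].

Definition Bv_ (R : realType) (h : weight R) (v : posn) : (R[i]^o)^nat :=
  fun n => weight_of h
    [set w | [/\ walks_from1 n w, vtx w n = vertex1 &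
                 forall i, (i <= n)%N -> vtx w i != v]].

Definition C_ (R : realType) (h : weight R) (v : posn) : (R[i]^o)^nat :=
  fun n => weight_of h
    [set w | [/\ walks_from1 n w, vtx w n = v &
                 forall i, (i < n)%N -> vtx w i != v]].

Definition E_ (R : realType) (h : weight R) (v : posn) : (R[i]^o)^nat :=
  fun n => weight_of h
    [set w | [/\ walks_from1 n w, vtx w n = v &
                 forall i, (0 < i < n)%N -> vtx w i != vertex1 /\ vtx w i != v]].

Definition at1_exists (R : realType) (u : (R[i]^o)^nat) : Prop :=
  cvgn (series u).

Definition at1 (R : realType) (u : (R[i]^o)^nat) : R[i]^o := limn (series u).

Definition sqrt_set (R : realType) (z : R[i]^o) : set (R[i]^o) :=
  [set x | x ^+ 2 = z].

(* The quotient with the convention 0 / 0 = 1. *)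
Definition quot01 (R : realType) (x y : R[i]^o) : R[i]^o :=
  if (x == 0) && (y == 0) then 1 else x / y.

(* Main.v *)
Require Import Defs.
From HB Require Import structures.
From mathcomp Require Import all_boot all_order all_algebra finmap complex.
From mathcomp Require Import all_classical all_reals all_analysis.
From mathcomp Require Import zify.

Import Order.TTheory GRing.Theory Num.Theory numFieldNormedType.Exports.

Local Open Scope ring_scope.
Local Open Scope classical_set_scope.

(* By convexity, prolonging walks by one step preserves their total weight, so
   a_n is the n-th partial sum of C_{h,v} and its limit is C := C_{h,v}(1)_1.
   Splitting walks at the first visit to v, and using transitivity and the
   reversal of walks, gives B_h = B_{h,v} + C_{h,v}^2 B_h; splitting at the last
   visit to 1 gives C_{h,v} = B_{h,v} E_{h,v}.  The series need not converge
   absolutely at 1, so these identities are evaluated there by comparing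
   iterated Cesaro means, i.e. the coefficients after division by (1 - x)^3
   and (1 - x)^2: B_h(1) - B_{h,v}(1) = B_h(1) C^2 and
   C = B_{h,v}(1) E_{h,v}(1).  When B_h(1) = 0, the former yields
   B_{h,v}(1) = 0 and then the latter C = 0. *)

Set Implicit Arguments.
Unset Strict Implicit.
Unset Printing Implicit Defensive.

(** * Unconditional sums *)

(* Unlike [sum_on], a relation: it carries the existence of the limit. *)
Definition has_sum (K : numFieldType) (X : choiceType) (D : set X) (g : X -> K)
    (s : K) : Prop :=
  forall e : K, 0 < e -> exists F : {fset X}, [set` F] `<=` D /\
    forall Y : {fset X}, (F `<=` Y)%fset -> [set` Y] `<=` D ->
      `|s - \sum_(x <- Y) g x| < e.

Section HasSum.
Variable K : numFieldType.
Implicit Types (X Y : choiceType) (s t c : K).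

Lemma has_sum_unique X (D : set X) (g : X -> K) s t :
  has_sum D g s -> has_sum D g t -> s = t.
Proof.
move=> hs ht; apply/eqP; rewrite -subr_eq0; apply/negPn/negP => st0.
have e0 : 0 < `|s - t| / 2 by rewrite divr_gt0 ?normr_gt0.
have [F [FD hF]] := hs _ e0; have [G [GD hG]] := ht _ e0.
have FGD : [set` (F `|` G)%fset] `<=` D.
  by move=> x /=; rewrite inE => /orP[/FD|/GD].
have := ltrD (hF _ (fsubsetUl F G) FGD) (hG _ (fsubsetUr F G) FGD).
rewrite -splitr distrC => /(le_lt_trans (ler_normD _ _)).
set S := \sum_(x <- _) _.
by rewrite distrC [X in `|X| < _]addrC addrA subrK distrC ltxx.
Qed.

Lemma eq_has_sum X (D : set X) (g g' : X -> K) s :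
  (forall x, D x -> g x = g' x) -> has_sum D g s -> has_sum D g' s.
Proof.
move=> gg' hs e /hs[F [FD hF]]; exists F; split=> // Y FY YD.
rewrite (_ : \sum_(x <- Y) g' x = \sum_(x <- Y) g x) ?hF//.
by rewrite big_seq [RHS]big_seq; apply: eq_bigr => x /YD/gg'.
Qed.

Lemma has_sumD X (D : set X) (g g' : X -> K) s t :
  has_sum D g s -> has_sum D g' t -> has_sum D (fun x => g x + g' x) (s + t).
Proof.
move=> hs ht e e0; have e20 : 0 < e / 2 by rewrite divr_gt0.
have [F [FD hF]] := hs _ e20; have [G [GD hG]] := ht _ e20.
exists (F `|` G)%fset; split=> [x /=|Y FY YD].
  by rewrite inE => /orP[/FD|/GD].
rewrite big_split /= opprD addrACA [e]splitr.
apply: le_lt_trans (ler_normD _ _) (ltrD (hF _ _ _) (hG _ _ _)) => //.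
  exact: fsubset_trans (fsubsetUl _ _) FY.
exact: fsubset_trans (fsubsetUr _ _) FY.
Qed.

Lemma has_sumZ X (D : set X) (g : X -> K) c s :
  has_sum D g s -> has_sum D (fun x => c * g x) (c * s).
Proof.
move=> hs e e0; have c0 : 0 < `|c| + 1 by rewrite ltr_wpDl.
have [F [FD hF]] := hs _ (divr_gt0 e0 c0); exists F; split=> // Y FY YD.
rewrite -mulr_sumr -mulrBr normrM.
apply: le_lt_trans (_ : (`|c| + 1) * `|s - \sum_(x <- Y) g x| < e).
  by rewrite ler_wpM2r// lerDl.
by rewrite mulrC -ltr_pdivlMr ?hF.
Qed.

Lemma has_sum_finite X (F : {fset X}) (g : X -> K) :
  has_sum [set` F] g (\sum_(x <- F) g x).
Proof.
move=> e e0; exists F; split=> // Y FY YF.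
suff -> : Y = F by rewrite subrr normr0.
by apply/eqP; rewrite eqEfsubset FY andbT; apply/fsubsetP.
Qed.

(* The choice of finite sets [G y] approximating the fibre sums makes this
   hold without absolute convergence of the outer sum. *)
Lemma has_sum_fibers X Y (p : X -> Y) (D : set X) (E : set Y) (g : X -> K)
    (t : Y -> K) s :
  (forall x, D x -> E (p x)) ->
  has_sum D g s ->
  (forall y, E y -> has_sum (D `&` p @^-1` [set y]) g (t y)) ->
  has_sum E t s.
Proof.
move=> DE hs ht e e0; have e20 : 0 < e / 2 by rewrite divr_gt0.
have [F [FD hF]] := hs _ e20.
exists [fset p x | x in F]%fset; split=> [y /= /imfsetP[x /= xF ->]|Z FZ ZE].
  exact/DE/FD.
(* One tolerance per fibre: the errors over [Z] add up to at most [e / 2]. The successor covers an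
   empty [Z]. *)
pose d : K := e / 2 / (size Z).+1%:R.
have d0 : 0 < d by rewrite divr_gt0.
have /choice[G hG] : forall y, exists G : {fset X}, E y ->
    [/\ [set` G] `<=` D `&` p @^-1` [set y],
        (forall x, x \in F -> p x = y -> x \in G) &
        `|t y - \sum_(x <- G) g x| < d].
  move=> y; have [Ey|nEy] := pselect (E y); last by exists fset0.
  have [H [HD hH]] := ht y Ey _ d0.
  (* [H] gives the accuracy within the fibre; the points of [F] over [y] are added so that the union
     [U] below contains [F]. *)
  exists (H `|` [fset x in F | p x == y])%fset => _.
  have HFD : [set` (H `|` [fset x in F | p x == y])%fset] `<=`
      D `&` p @^-1` [set y].
    by move=> x /=; rewrite !inE /= => /orP[/HD//|/andP[/FD ? /eqP]].
  split=> //; last exact/hH/HFD/fsubsetUl.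
  by move=> x xF pxy; rewrite !inE xF pxy eqxx orbT.
pose U : {fset X} := (\bigcup_(y <- Z) G y)%fset.
have UP x : reflect (exists2 y, y \in Z & x \in G y) (x \in U).
  apply: (iffP (bigfcupP _ _ _ _)) => [[y /andP[yZ _] xG]|[y yZ xG]].
    by exists y.
  by exists y; rewrite ?yZ.
have UD : [set` U] `<=` D.
  by move=> x /= /UP[y yZ]; have [GD _ _] := hG y (ZE _ yZ); move=> /GD[].
have FU : (F `<=` U)%fset.
  apply/fsubsetP => x xF; apply/UP; exists (p x).
    by apply: (fsubsetP FZ); apply/imfsetP; exists x.
  have pxZ : p x \in Z by apply: (fsubsetP FZ); apply/imfsetP; exists x.
  by have [_ GF _] := hG _ (ZE _ pxZ); apply: GF.
have sumU : \sum_(x <- U) g x = \sum_(y <- Z) \sum_(x <- G y) g x.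
  rewrite /U; apply: partition_disjoint_bigfcup => // i j /ZE Ei /ZE Ej ij.
  have [Gi _ _] := hG i Ei; have [Gj _ _] := hG j Ej.
  apply/fdisjointP => x /Gi[_ /= pxi]; apply/negP => /Gj[_ /= pxj].
  by move: ij; rewrite -pxi -pxj eqxx.
rewrite (_ : s - _ = (s - \sum_(x <- U) g x) +
    \sum_(y <- Z) (\sum_(x <- G y) g x - t y)); last first.
  by rewrite sumrB -sumU addrA subrK.
rewrite [e]splitr; apply: le_lt_trans (ler_normD _ _) _.
apply: ltr_leD; first exact: hF.
apply: le_trans (ler_norm_sum _ _ _) _.
apply: le_trans (_ : \sum_(y <- Z) d <= _).
  rewrite big_seq [leRHS]big_seq; apply: ler_sum => y /ZE Ey.
  by have [_ _ /ltW] := hG y Ey; rewrite distrC.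
rewrite big_const_seq count_predT iter_addr_0 /d.
rewrite -[_ *+ _]mulr_natr -mulrA ger_pMr// mulrC.
by rewrite ler_pdivrMr// mul1r ler_nat.
Qed.

(** The fibres of a bijection are singletons, so [has_sum_fibers] applies. *)
Lemma has_sum_reindex X Y (q : X -> Y) (D : set X) (E : set Y) (g : X -> K)
    (g' : Y -> K) s :
  set_bij D E q -> (forall x, D x -> g x = g' (q x)) ->
  has_sum D g s -> has_sum E g' s.
Proof.
move=> [qDE qinj qsurj] gg' hs; apply: (has_sum_fibers qDE hs) => y Ey.
have [x Dx qxy] := qsurj _ Ey.
have -> : D `&` q @^-1` [set y] = [set` [fset x]%fset].
  apply/seteqP; split=> z /=; rewrite inE; last by move/eqP->.
  by case=> Dz qzy; apply/eqP; apply: qinj; rewrite ?inE// qzy qxy.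
rewrite -qxy -gg'//; have := has_sum_finite [fset x]%fset g.
by rewrite big_seq_fset1.
Qed.

(** Sending a point to the index of its block turns the blocks into fibres over a finite set, where
    the sum of the fibre sums is an ordinary one. *)
Lemma has_sum_partition X n (D : set X) (P : nat -> set X) (g : X -> K)
    (t : nat -> K) s :
  (forall k, (k <= n)%N -> P k `<=` D) ->
  (forall x, D x -> exists2 k, (k <= n)%N & P k x) ->
  (forall x j k, P j x -> P k x -> j = k) ->
  has_sum D g s -> (forall k, (k <= n)%N -> has_sum (P k) g (t k)) ->
  s = \sum_(k < n.+1) t k.
Proof.
move=> PD Pcover Pdisj hs ht.
have /choice[p hp] : forall x, exists k, D x -> (k <= n)%N /\ P k x.
  move=> x; have [Dx|nDx] := pselect (D x); last by exists 0%N.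
  by have [k kn Pk] := Pcover x Dx; exists k.
pose E : {fset nat} := seq_fset tt (iota 0 n.+1).
have EE k : k \in E = (k <= n)%N by rewrite seq_fsetE mem_iota.
have : has_sum [set` E] t s.
  apply: (has_sum_fibers (p := p) _ hs) => [x /hp[] /=|k /=]; rewrite EE//.
  move=> kn; suff -> : D `&` p @^-1` [set k] = P k by apply: ht.
  apply/seteqP; split=> x /= => [[Dx <-]|Px]; first by have [] := hp x Dx.
  have Dx := PD _ kn _ Px; split=> //.
  by have [_ Ppx] := hp x Dx; apply: Pdisj Ppx Px.
move/has_sum_unique => /(_ _ (has_sum_finite E t)) ->.
rewrite -(big_mkord predT t) /index_iota subn0; apply: perm_big.
by rewrite uniq_perm ?fset_uniq ?iota_uniq// => k; rewrite EE mem_iota.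
Qed.

Lemma has_sum_zero X (D : set X) : has_sum D (fun=> 0) (0 : K).
Proof.
by move=> e e0; exists fset0; split=> // Y _ _; rewrite big1// subrr normr0.
Qed.

End HasSum.

(** * Absolute convergence yields unconditional sums *)

Local Open Scope complex_scope.

(** The finite partial sums grow with the finite set, so their supremum is the sum. *)
Lemma has_sum_nonneg (R : realType) (X : choiceType) (D : set X) (g : X -> R)
    (M : R) :
  (forall x, 0 <= g x) ->
  (forall Y : {fset X}, [set` Y] `<=` D -> \sum_(x <- Y) g x <= M) ->
  exists s, has_sum D g s.
Proof.
move=> g0 gM.
pose A := [set r | exists2 Y : {fset X}, [set` Y] `<=` D & r = \sum_(x <- Y) g x].
have supA : has_sup A.
  split; first by exists 0, fset0; rewrite ?big_seq_fset0.
  by exists M => r [Y YD ->]; apply: gM.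
exists (sup A) => e e0; have [_ [F FD ->] hF] := sup_adherent e0 supA.
exists F; split=> // Y FY YD; rewrite ger0_norm; last first.
  by rewrite subr_ge0; apply: ub_le_sup; [case: supA|exists Y].
rewrite ltrBlDr addrC -ltrBlDr; apply: lt_le_trans hF _.
rewrite [leRHS](big_fsetID _ (mem F)) /= (_ : [fset x in Y | x \in F]%fset = F).
  by rewrite lerDl sumr_ge0.
by apply/fsetP => x; rewrite !inE andbC; case: (boolP (x \in F)) => //= /(fsubsetP FY).
Qed.

Lemma has_sum_complex (R : realType) (X : choiceType) (D : set X) (r : X -> R)
    (s : R) :
  has_sum D r s -> has_sum D (fun x => (r x)%:C : R[i]) s%:C.
Proof.
(* A positive element of [R[i]] is real, so its real part serves as a tolerance in [R]. *)
move=> hs e e0; move: (e0); rewrite ltcE /= => /andP[/eqP Ime Ree].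
have [F [FD hF]] := hs _ Ree; exists F; split=> // Y FY YD.
rewrite -rmorph_sum -rmorphB /= normc_def /= expr0n addr0 sqrtr_sqr.
by rewrite ltcE /= Ime eqxx hF.
Qed.

(** [r] is the difference of the nonnegative families [|r| + r] and [|r|], whose finite sums are
    bounded by [2M] and [M]. *)
Lemma has_sum_real (R : realType) (X : choiceType) (D : set X) (r : X -> R)
    (M : R) :
  (forall Y : {fset X}, [set` Y] `<=` D -> \sum_(x <- Y) `|r x| <= M) ->
  exists s, has_sum D r s.
Proof.
move=> rM.
have [s hs] : exists s, has_sum D (fun x => `|r x| + r x) s.
  apply: (@has_sum_nonneg _ _ _ _ (M *+ 2)) => [x|Y YD].
    by rewrite -lerBlDr sub0r -normrN ler_norm.
  apply: le_trans (_ : (\sum_(x <- Y) `|r x|) *+ 2 <= _).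
    by rewrite -sumrMnl; apply: ler_sum => x _; rewrite mulr2n lerD2l ler_norm.
  by rewrite lerMn2r rM.
have [t ht] : exists t, has_sum D (fun x => `|r x|) t.
  exact: has_sum_nonneg rM.
exists (s + -1 * t); apply: eq_has_sum (has_sumD hs (has_sumZ (-1) ht)) => x _.
by rewrite mulN1r addrAC subrr add0r.
Qed.

Lemma has_sum_abs_cvg (R : realType) (X : choiceType) (D : set X)
    (g : X -> R[i]) :
  abs_cvg D g -> exists s, has_sum D g s.
Proof.
move=> [M gM].
have bound (p : X -> R) : (forall x, `|p x|%:C <= `|g x|) ->
    exists s, has_sum D p s.
  move=> pg; apply: (@has_sum_real _ _ _ _ M) => Y YD.
  rewrite -lecR rmorph_sum; apply: le_trans (gM Y YD).
  by apply: ler_sum => x _; exact: pg.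
have [a ha] := bound (fun x => complex.Re (g x)) (fun x => normc_ge_Re (g x)).
have [b hb] : exists s, has_sum D (fun x => complex.Im (g x)) s.
  apply: bound => x; rewrite normc_def lecR -sqrtr_sqr ler_wsqrtr//.
  by rewrite lerDr sqr_ge0.
exists (a%:C + 'i * b%:C).
apply: eq_has_sum (has_sumD (has_sum_complex ha) (has_sumZ _ (has_sum_complex hb))).
by move=> x _; rewrite -complexE.
Qed.

(** Extension by zero turns the sum over a finite [Y] into one over the part of [Y] in [D], which
    still contains the approximating set [F]. *)
Lemma sum_on_has_sum (R : realType) (X : choiceType) (D : set X)
    (g : X -> R[i]) (s : R[i]) :
  has_sum D g s -> sum_on D g = s.
Proof.
move=> hs; rewrite /sum_on /summability.sum.
have -> : summability.partial_sum (fun x => if x \in D then g x else 0) =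
    (fun Y : {fset X} => \sum_(x <- Y) if x \in D then g x else 0).
  by apply/funext => Y; rewrite /summability.partial_sum big_seq_fsetE.
have totallyF := @summability.totally_filter X.
apply: (@cvg_lim R[i]^o); first exact: norm_hausdorff.
apply/cvgrPdist_lt => e e0.
have [F [FD hF]] := hs _ e0; exists F => // Y /= FY.
rewrite -big_mkcond /= big_fset_condE.
apply: hF => [|x /=]; last by rewrite !inE => /andP[_ /set_mem].
apply/fsubsetP => x xF; rewrite !inE (fsubsetP FY)//=.
exact/mem_set/FD.
Qed.

(** * Cauchy products and Cesaro means *)

Definition cauchy_prod (K : pzSemiRingType) (a b : nat -> K) (n : nat) : K :=
  \sum_(k < n.+1) a k * b (n - k)%N.

Section CauchyProduct.
Variable K : comNzRingType.
Implicit Types a b c : nat -> K.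

(** Truncating series to polynomials lets commutativity and associativity of Cauchy products be read
    off from polynomial multiplication. *)
Lemma coef_cauchy_prod a b n N : (n <= N)%N ->
  cauchy_prod a b n = ((\poly_(i < N.+1) a i) * (\poly_(i < N.+1) b i))`_n.
Proof.
move=> nN; rewrite coefM; apply: eq_bigr => k _; rewrite !coef_poly !ltnS.
by rewrite (leq_trans (leq_ord k) nN) (leq_trans (leq_subr _ _) nN).
Qed.

Lemma cauchy_prodC a b : cauchy_prod a b = cauchy_prod b a.
Proof.
by apply/funext => n; rewrite !(coef_cauchy_prod _ _ (leqnn n)) mulrC.
Qed.

Lemma cauchy_prodA a b c :
  cauchy_prod a (cauchy_prod b c) = cauchy_prod (cauchy_prod a b) c.
Proof.
apply/funext => n; pose P f := \poly_(i < n.+1) (f i : K).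
transitivity ((P a * (P b * P c))`_n); last rewrite mulrA.
  rewrite coefM; apply: eq_bigr => k _.
  by rewrite coef_poly ltn_ord (coef_cauchy_prod _ _ (leq_subr k n)).
rewrite coefM; apply: eq_bigr => k _.
by rewrite coef_poly ltnS leq_subr (coef_cauchy_prod _ _ (leq_ord k)).
Qed.

Lemma cauchy_prodBl a b c :
  cauchy_prod (fun n => a n - b n) c =
  (fun n => cauchy_prod a c n - cauchy_prod b c n).
Proof.
apply/funext => n; rewrite /cauchy_prod -sumrB.
by apply: eq_bigr => k _; rewrite mulrBl.
Qed.

End CauchyProduct.

(** * Weighted averages of Cauchy products *)

Section Toeplitz.
Variable K : numFieldType.

Lemma cvg_bounded (x : nat -> K^o) (l : K^o) : x @ \oo --> l ->
  exists2 M : K, 0 < M & forall n, `|x n| <= M.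
Proof.
move=> /cvgrPdist_lt /(_ 1 ltr01)[N _ hN].
pose M : K := \sum_(i < N) `|x i| + (`|l| + 1).
have M0 : 0 <= \sum_(i < N) `|x i| by apply: sumr_ge0.
exists M => [|n]; first by rewrite ltr_wpDl// ltr_wpDl.
have [nN|Nn] := ltnP n N.
  rewrite /M (bigD1 (Ordinal nN))//= -addrA lerDl.
  by rewrite !addr_ge0// sumr_ge0.
apply: le_trans (_ : `|l| + 1 <= _); last by rewrite lerDr.
rewrite -[x n](subrK l) addrC; apply: le_trans (ler_normD _ _) _.
by rewrite lerD2l distrC ltW// hN.
Qed.

(** Counts the exceptional indices of the averaging argument: at most [N] near each end, the two
    ends being exchanged by [k -> n - k]. *)
Lemma sum_near_ends (n N : nat) :
  \sum_(k < n.+1) ((k < N) + (n - k < N))%:R <= (N + N)%:R :> K.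
Proof.
rewrite -natr_sum ler_nat big_split /=.
have le_N : (\sum_(k < n.+1) (k < N) <= N)%N.
  rewrite -(big_mkord xpredT (fun k => nat_of_bool (k < N)%N)).
  elim: n => [|n IHn]; first by rewrite big_nat1; case: N.
  rewrite big_nat_recr//=; have [nN|Nn] := ltnP n.+1 N; last by rewrite addn0.
  rewrite addn1 (leq_ltn_trans _ nN)//.
  rewrite -[X in (_ <= X)%N]muln1 -[n.+1 in leqRHS]subn0 -sum_nat_const_nat.
  by apply: leq_sum => i _; case: ltnP.
apply: leq_add => //; rewrite (reindex_inj rev_ord_inj) /=.
rewrite (eq_bigr (fun k : 'I_n.+1 => nat_of_bool (k < N)%N)) // => k _.
by rewrite subSS subKn// leq_ord.
Qed.

(* A Toeplitz averaging argument: as the weights are monotone and each is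
   negligible against their sum, only indices [k] with both [k] and [n - k]
   large matter. *)
Lemma toeplitz_mean (w : nat -> K) (x y : nat -> K^o) (l m : K^o) :
  {homo w : i j / (i <= j)%N >-> i <= j} -> 0 < w 0%N ->
  ((fun n => w n / \sum_(k < n.+1) w k) : nat -> K^o) @ \oo --> (0 : K^o) ->
  x @ \oo --> l -> y @ \oo --> m ->
  ((fun n => @cauchy_prod K (fun k => w k * x k) y n / \sum_(k < n.+1) w k)
    : nat -> K^o) @ \oo --> (l * m : K^o).
Proof.
move=> wmono w0 wW xl ym.
have wgt0 k : 0 < w k by apply: lt_le_trans w0 (wmono _ _ (leq0n k)).
have Wgt0 n : 0 < \sum_(k < n.+1) w k.
  by rewrite big_ord_recl ltr_pwDl// sumr_ge0// => i _; apply: ltW.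
have [Mx Mx0 hMx] := cvg_bounded xl; have [My My0 hMy] := cvg_bounded ym.
(* A bound on [|l * m - x k * y (n - k)|] valid for every [k], used near the ends. *)
pose M : K := Mx * My + `|l * m|.
have M0 : 0 < M by rewrite ltr_pwDl// mulr_gt0.
apply/cvgrPdist_lt => e e0.
have e20 : 0 < e / 2 by rewrite divr_gt0.
pose d : K := e / 2 / (`|l| + My + 1).
have lM0 : 0 < `|l| + My + 1 by rewrite ltr_wpDl// addr_ge0// ltW.
have d0 : 0 < d by rewrite divr_gt0.
have /cvgrPdist_lt/(_ _ d0)[Nx _ hNx] := xl.
have /cvgrPdist_lt/(_ _ d0)[Ny _ hNy] := ym.
pose N := maxn Nx Ny.
(* At most [N + N] indices are exceptional, each costing at most [w n * M]; the successor keeps the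
   denominator positive when [N = 0]. *)
pose d' : K := e / 2 / ((N + N).+1%:R * M).
have NM0 : 0 < (N + N).+1%:R * M by rewrite mulr_gt0.
have d'0 : 0 < d' by rewrite divr_gt0.
have /cvgrPdist_lt/(_ _ d'0)[N' _ hN'] := wW.
exists N' => // n /= N'n; set W := \sum_(k < n.+1) w k.
(* The first summand pays for indices far from both ends; the second pays for the others, where
   [w k <= w n] by monotonicity. *)
have term (k : 'I_n.+1) : `|w k * (l * m - x k * y (n - k)%N)| <=
    w k * (e / 2) + w n * (M * ((k < N) + (n - k < N))%:R).
  rewrite normrM gtr0_norm//; set z : K := `|_|.
  have z0 : 0 <= z := normr_ge0 _.
  have zM : z <= M.
    rewrite /z distrC; apply: le_trans (ler_normB _ _) _.
    by rewrite lerD2r normrM ler_pM.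
  have wkn : w k <= w n by apply: wmono; apply: leq_ord.
  have [kN|Nk] := ltnP k N.
    apply: le_trans (_ : w n * (M * (1 + (n - k < N))%:R) <= _).
      apply: ler_pM => //; first exact: ltW.
      apply: le_trans zM _; rewrite ler_peMr//; first exact: ltW.
      by rewrite ler1n.
    by rewrite lerDr mulr_ge0// ltW.
  have [nkN|Nnk] := ltnP (n - k) N.
    rewrite add0n mulr1; apply: le_trans (_ : w n * M <= _).
      by apply: ler_pM => //; exact: ltW.
    by rewrite lerDr mulr_ge0// ltW.
  rewrite !mulr0 addr0 ler_pM2l// /z.
  rewrite (_ : _ - _ = l * (m - y (n - k)%N) + (l - x k) * y (n - k)%N); last first.
    by rewrite mulrBr mulrBl addrA subrK.
  apply: le_trans (ler_normD _ _) _; rewrite !normrM.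
  apply: le_trans (_ : (`|l| + My) * d <= _).
    rewrite mulrDl lerD//; first rewrite ler_wpM2l// ltW// hNy//=.
      by rewrite (leq_trans _ Nnk)// leq_maxr.
    rewrite mulrC ler_pM// ltW// hNx//=.
    by rewrite (leq_trans _ Nk)// leq_maxl.
  rewrite /d mulrA ler_pdivrMr// [leLHS]mulrC ler_pM2l//.
  by rewrite lerDl.
(* The constant [l * m] is its own weighted average, so the error is an average of errors. *)
rewrite (_ : l * m - _ =
    (\sum_(k < n.+1) w k * (l * m - x k * y (n - k)%N)) / W); last first.
  rewrite /cauchy_prod.
  under [in RHS]eq_bigr do rewrite mulrBr.
  rewrite sumrB mulrBl -mulr_suml mulrAC divff ?gt_eqF// mul1r.
  by congr (_ - _ / _); apply: eq_bigr => k _; rewrite mulrA.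
rewrite normrM normfV (gtr0_norm (Wgt0 n)) ltr_pdivrMr//.
apply: le_lt_trans (ler_norm_sum _ _ _) _.
apply: le_lt_trans (ler_sum _ (fun k _ => term k)) _.
rewrite big_split /= -mulr_suml -2!mulr_sumr -/W [X in _ < X]mulrC.
rewrite [in X in _ < X](splitr e) mulrDr ltrD2l.
apply: le_lt_trans (_ : w n * (M * (N + N).+1%:R) < _).
  rewrite ler_pM2l// ler_pM2l//; apply: le_trans (sum_near_ends _ _) _.
  by rewrite ler_nat.
have := hN' n N'n; rewrite /= sub0r normrN.
rewrite gtr0_norm ?divr_gt0 ?(Wgt0 n)// -/W ltr_pdivrMr ?(Wgt0 n)//.
move=> wn; rewrite [M * _]mulrC.
have -> : W * (e / 2) = d' * W * ((N + N).+1%:R * M).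
  by rewrite mulrAC /d' divfK ?gt_eqF// mulrC.
by rewrite ltr_pM2r.
Qed.

End Toeplitz.

Lemma cvg_harmonic_complex (R : realType) :
  ((fun n => n.+1%:R^-1) : nat -> R[i]^o) @ \oo --> (0 : R[i]^o).
Proof.
apply/cvgrPdist_lt => e; rewrite ltcE /= => /andP[/eqP Ime Ree].
have [N _ hN] := (cvgrPdist_lt (@harmonic R) 0).1 (@cvg_harmonic R) _ Ree.
exists N => // n /hN /=; rewrite !sub0r !normrN !ger0_norm ?invr_ge0// => he.
rewrite -(rmorph_nat (real_complex R)) -fmorphV ltcE /= Ime eqxx /=.
exact: he.
Qed.

(** * Cesaro means and evaluation of product identities at 1 *)

Section CauchyMeans.
Variable R : realType.
Implicit Types x y u a b c : nat -> R[i]^o.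
Local Notation conv := (@cauchy_prod R[i]).

Let one : nat -> R[i] := fun=> 1.

Lemma cauchy_mean1 x y (l m : R[i]^o) :
  x @ \oo --> l -> y @ \oo --> m ->
  ((fun n => conv x y n / n.+1%:R) : nat -> R[i]^o) @ \oo
    --> (l * m : R[i]^o).
Proof.
move=> xl ym.
have W n : \sum_(k < n.+1) (1 : R[i]) = n.+1%:R.
  by rewrite big_const_ord iter_addr_0.
have := @toeplitz_mean _ one x y l m (fun _ _ _ => lexx _) ltr01 _ xl ym.
rewrite /one (_ : (fun n => _) = fun n => n.+1%:R^-1); last first.
  by apply/funext => n; rewrite W div1r.
move=> /(_ (@cvg_harmonic_complex R)).
rewrite (_ : (fun n => _ / _) = fun n => conv x y n / n.+1%:R) //.
apply/funext => n; rewrite W; congr (_ / _).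
by apply: eq_bigr => k _; rewrite mul1r.
Qed.

(** Triangular numbers, the coefficients of [1 / (1 - x)^3]; they normalise the second-order
    means. *)
Let tri n : R[i] := \sum_(k < n.+1) k.+1%:R.

(** [toeplitz_mean] with weights [k + 1]: these cancel the denominators of the means of [x], so [x]
    itself need not converge. *)
Lemma cauchy_mean2 x y (l m : R[i]^o) :
  ((fun n => x n / n.+1%:R) : nat -> R[i]^o) @ \oo --> l -> y @ \oo --> m ->
  ((fun n => conv x y n / tri n) : nat -> R[i]^o) @ \oo
    --> (l * m : R[i]^o).
Proof.
move=> xl ym.
have triE n : tri n = n.+1%:R * n.+2%:R / 2.
  have n2 : (2 : R[i]) != 0 by rewrite pnatr_eq0.
  apply: (mulIf n2).
  rewrite divfK ?pnatr_eq0// /tri -natr_sum -!natrM; congr (_%:R).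
  elim: n => [|n IHn]; first by rewrite big_ord1.
  by rewrite big_ord_recr mulnDl IHn [(n.+1 * _)%N]mulnC -mulnDr addn2.
have wmono : {homo (fun k => k.+1%:R : R[i]) : i j / (i <= j)%N >-> i <= j}.
  by move=> i j ij; rewrite ler_nat.
(* The quotient is [2 / (n + 2)], at most twice the harmonic term [1 / (n + 1)]. *)
have wtri : ((fun n => n.+1%:R / tri n) : nat -> R[i]^o) @ \oo --> (0 : R[i]^o).
  apply/cvgrPdist_lt => e e0; have e20 : 0 < e / 2 by rewrite divr_gt0.
  have /cvgrPdist_lt/(_ _ e20)[N _ hN] := @cvg_harmonic_complex R.
  exists N => // n /hN /=; rewrite !sub0r !normrN triE.
  rewrite invf_div invfM mulrCA mulVKf ?pnatr_eq0//.
  rewrite !ger0_norm ?divr_ge0 ?invr_ge0 ?ler0n// ltr_pdivlMr// mulrC.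
  by apply: le_lt_trans; rewrite ler_pM2l// lef_pV2 ?posrE ?ltr0n// ler_nat.
have := @toeplitz_mean _ (fun k => k.+1%:R) _ y l m wmono (ltr0Sn _ 0) wtri xl ym.
rewrite (_ : (fun n => _ / _) = fun n => conv x y n / tri n) //.
apply/funext => n; congr (_ / _).
by apply: eq_bigr => k _; rewrite [_%:R * _]mulrC divfK ?pnatr_eq0.
Qed.

Lemma cvg_mean_conv1 x (l : R[i]^o) : x @ \oo --> l ->
  ((fun n => conv x one n / n.+1%:R) : nat -> R[i]^o) @ \oo --> l.
Proof.
move=> xl.
have := cauchy_mean1 xl (@cvg_cst R[i]^o 1 _ (\oo : set_system nat) _).
rewrite mulr1; exact.
Qed.

(** Convolution with [one] is multiplication by [1 / (1 - x)], so partial sums can be moved around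
    inside Cauchy products. *)
Let psum u : nat -> R[i] := conv u one.

Lemma cvg_psum u : cvgn (series u) -> psum u @ \oo --> (limn (series u) : R[i]^o).
Proof.
(* [psum u n] includes the term of index [n], whereas [series u n] stops before it. *)
move=> cu; have -> : psum u = (fun n => series u n.+1).
  apply/funext => n; rewrite /psum /cauchy_prod /series /= big_mkord.
  by apply: eq_bigr => k _; rewrite mulr1.
by rewrite (@cvg_shiftS R[i]^o (series u)).
Qed.

(** Abel's theorem on products of convergent series: after division by [(1 - x)^2], both sides of
    [c = a b] have Cesaro means with known limits. *)
Lemma lim_series_prod2 a b c :
  cvgn (series a) -> cvgn (series b) -> cvgn (series c) ->
  c = conv a b ->
  limn (series c) = limn (series a) * limn (series b) :> R[i].
Proof.
move=> /cvg_psum ca /cvg_psum cb /cvg_psum cc abc.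
have h := cauchy_mean1 ca cb; have h' := cvg_mean_conv1 cc.
apply: (@cvg_unique R[i]^o _ _ _ _ _ h'); first exact: norm_hausdorff.
have -> : conv (psum c) one = conv (psum a) (psum b).
  rewrite /psum abc -!cauchy_prodA; congr conv.
  by rewrite !cauchy_prodA (cauchy_prodC b).
exact: h.
Qed.

(** The series of [c a] is not known to converge, only the means of its double sums; hence the
    division by [(1 - x)^3], which gives one factor [1 / (1 - x)] to each of [c], [a], [c]. *)
Lemma lim_series_prod3 a b c :
  cvgn (series a) -> cvgn (series b) -> cvgn (series c) ->
  (fun n => a n - b n) = conv (conv c a) c ->
  limn (series a) - limn (series b) = limn (series a) * limn (series c) ^+ 2 :> R[i].
Proof.
move=> /cvg_psum ca /cvg_psum cb /cvg_psum cc abc.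
have h := cauchy_mean2 (cauchy_mean1 cc ca) cc.
have cab : (psum a - psum b : nat -> R[i]^o) @ \oo
    --> (limn (series a) - limn (series b) : R[i]^o).
  apply: (@cvgB R[i] R[i]^o nat \oo _ (psum a) (psum b) _ _ ca cb).
have h' := cauchy_mean2 (cvg_mean_conv1 cab) (@cvg_cst R[i]^o 1 _ (\oo : set_system nat) _).
have E : conv (conv (psum a - psum b) one) one =
    conv (conv (psum c) (psum a)) (psum c).
  have -> : psum a - psum b = conv (fun n => a n - b n) one.
    by rewrite cauchy_prodBl.
  rewrite abc /psum.
  have swap x y : conv (conv x y) one = conv (conv x one) y.
    by rewrite -!cauchy_prodA (cauchy_prodC y).
  by rewrite !cauchy_prodA !(swap _ c) !(swap _ a).
rewrite E in h'.
have := cvg_unique (@norm_hausdorff _ R[i]^o) (h' _) h.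
by rewrite mulr1 => ->; rewrite mulrC mulrA mulrC expr2.
Qed.

End CauchyMeans.

(** * Weights of walks *)

Local Arguments vtx : simpl never.

Definition walks_between (a b : posn) (n : nat) : set (seq posn) :=
  [set w | [/\ walk n w, vtx w 0 = a & vtx w n = b]].

Lemma vtx_take k w i : (i <= k)%N -> vtx (take k.+1 w) i = vtx w i.
Proof. by move=> ik; rewrite /vtx nth_take. Qed.

Lemma vtx_drop k w i : vtx (drop k w) i = vtx w (k + i)%N.
Proof. by rewrite /vtx nth_drop. Qed.

(** The two pieces share the vertex of index [k], whence [take k.+1] against [drop k]. *)
Lemma walk_split k n w : (k <= n)%N ->
  walk n w <-> [/\ size w = n.+1, walk k (take k.+1 w) & walk (n - k) (drop k w)].
Proof.
move=> kn; split=> [[sw ww]|[sw [_ w1] [_ w2]]]; split=> //.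
- split=> [|i ik]; first by rewrite size_take sw ltnS; case: ltngtP kn => // ->.
  by rewrite !vtx_take// ?ww ?(leq_trans ik)// ltnW.
- split=> [|i ik]; first by rewrite size_drop sw subSn.
  by rewrite !vtx_drop addnS ww// -ltn_subRL.
- move=> i ni; have [ik|ki] := ltnP i k.
    by have := w1 i ik; rewrite !vtx_take// ltnW.
  have := w2 (i - k)%N; rewrite !vtx_drop addnS subnKC//; apply.
  by rewrite ltn_sub2r// (leq_ltn_trans ki).
Qed.

Section Weights.
Variables (R : realType) (h : weight R).
Local Notation W := (walk_weight h).

Lemma edgeC a b : edge h a b = edge h b a.
Proof. by rewrite /edge fsetUC. Qed.

Lemma walk_weight_split k m w : size w = (k + m).+1 ->
  W w = W (take k.+1 w) * W (drop k w).
Proof.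
move=> sw; rewrite /walk_weight sw /= size_take size_drop sw.
have -> : (if (k.+1 < (k + m).+1)%N then k.+1 else (k + m).+1) = k.+1.
  by case: ltnP => //; rewrite ltnS => km; apply/eqP; rewrite eqSS eqn_leq km leq_addr.
rewrite subSn ?leq_addr// addKn /= big_split_ord /=; congr (_ * _).
  by apply: eq_bigr => i _; rewrite !vtx_take ?(ltnW (ltn_ord i)) ?ltn_ord.
by apply: eq_bigr => i _; rewrite !vtx_drop addnS.
Qed.

Lemma walk_weight_rcons n y x : size y = n.+1 ->
  W (rcons y x) = W y * edge h (vtx y n) x.
Proof.
move=> sy; rewrite /walk_weight size_rcons sy /= big_ord_recr /=; congr (_ * _).
  apply: eq_bigr => i _; rewrite /vtx !nth_rcons sy ltnS (ltnW (ltn_ord i)).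
  by rewrite ltnS ltn_ord.
by rewrite /vtx !nth_rcons sy ltnSn ltnn eqxx.
Qed.

Lemma walk_weight_rev n w : size w = n.+1 -> W (rev w) = W w.
Proof.
move=> sw; rewrite /walk_weight size_rev sw /= (reindex_inj rev_ord_inj) /=.
apply: eq_bigr => i _; rewrite /vtx !nth_rev ?sw ?ltnS ?leq_subr//.
  rewrite edgeC; congr (edge h (nth _ _ _) (nth _ _ _)); have := ltn_ord i; lia.
have := ltn_ord i; lia.
Qed.

Lemma walk_weight_map (f : posn -> posn) n w :
  (forall a b, a != b -> edge h (f a) (f b) = edge h a b) ->
  walk n w -> W (map f w) = W w.
Proof.
move=> hf [sw ww]; rewrite /walk_weight size_map sw /=; apply: eq_bigr => i _.
have := ltn_ord i => iN.
by rewrite /vtx !(nth_map vertex1) ?sw ?ltnS ?(ltnW iN)// hf// ww.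
Qed.

(** The walks with a given prefix [y] are [y] glued to the members of [D2], so this fibre sums to
    [W y * s2]; summing over [y] gives the product. *)
Lemma has_sum_concat k m (D D1 D2 : set (seq posn)) (s s1 s2 : R[i]) :
  (forall w, D1 w -> size w = k.+1) -> (forall w, D2 w -> size w = m.+1) ->
  (forall w1 w2, D1 w1 -> D2 w2 -> vtx w1 k = vtx w2 0) ->
  (forall w, D w <-> [/\ size w = (k + m).+1, D1 (take k.+1 w) & D2 (drop k w)]) ->
  has_sum D W s -> has_sum D1 W s1 -> has_sum D2 W s2 -> s = s1 * s2.
Proof.
move=> sz1 sz2 ends DE hs hs1 hs2.
have : has_sum D1 (fun w => s2 * W w) s.
  apply: (has_sum_fibers (p := take k.+1) _ hs) => [w /DE[]//|y D1y].
  have sy := sz1 _ D1y.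
  (* Gluing uses [behead] because the first vertex of [w] is already the last one of [y]. *)
  have dropq w : D2 w -> drop k (y ++ behead w) = w.
    move=> D2w; rewrite drop_cat sy ltnSn (drop_nth vertex1) ?sy//.
    rewrite [drop k.+1 y]drop_oversize ?sy// -[nth _ _ _]/(vtx y k).
    by rewrite (ends _ _ D1y D2w); case: w D2w => // /sz2.
  have takeq w : take k.+1 (y ++ behead w) = y by rewrite -sy take_size_cat.
  have qD w : D2 w -> D (y ++ behead w).
    move=> D2w; apply/DE; rewrite takeq dropq//; split=> //.
    by rewrite size_cat size_behead sy (sz2 _ D2w) addSn.
  apply: (@has_sum_reindex _ _ _ (fun w => y ++ behead w) D2 _
    (fun w => W y * W w)).
  - split=> [w D2w|w w' /set_mem D2w /set_mem D2w' qq|w [/= Dw yw]].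
    + by split; [exact: qD|exact: takeq].
    + by rewrite -(dropq _ D2w) qq dropq.
    + have [_ _ D2w] := (DE w).1 Dw; exists (drop k w) => //.
      by rewrite -yw -drop1 drop_drop add1n cat_take_drop.
  - move=> w D2w; have [sq _ _] := (DE _).1 (qD _ D2w).
    by rewrite (walk_weight_split sq) takeq dropq.
  - by rewrite mulrC; apply: has_sumZ.
by move/has_sum_unique => /(_ _ (has_sumZ s2 hs1)) ->; rewrite mulrC.
Qed.

Hypothesis h_light : light h.

(** Bounds on finite sums pass to subsets. Lightness concerns only walks from [1]; sums over walks
    from [v] are obtained by reversal or transport. *)
Lemma has_sum_weight n (P : set (seq posn)) :
  P `<=` walks_from1 n -> has_sum P W (weight_of h P).
Proof.
move=> PW; have [|s hs] := @has_sum_abs_cvg _ _ P W.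
  by have [M hM] := h_light n; exists M => Y YP; apply: hM => x /YP /PW.
by rewrite /weight_of (sum_on_has_sum hs).
Qed.

Lemma weight_ofU n (P Q : set (seq posn)) :
  P `<=` walks_from1 n -> Q `<=` walks_from1 n -> (forall w, P w -> ~ Q w) ->
  weight_of h (P `|` Q) = weight_of h P + weight_of h Q.
Proof.
move=> PW QW PQ; pose A k := if k is 0%N then P else Q.
rewrite -[RHS](_ : \sum_(k < 2) weight_of h (A k) = _); last first.
  by rewrite big_ord_recr big_ord1.
(* Blocks of index above 1 are made empty, since disjointness is required over all indices. *)
apply: (@has_sum_partition _ _ 1 (P `|` Q) (fun k => if k is k'.+2 then set0 else A k) W
  (fun k => weight_of h (A k))).
- by move=> [_ w ?|[_ w ?|//]]; [left|right].
- by move=> w [Pw|Qw]; [exists 0%N|exists 1%N].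
- move=> w [|[|j]] [|[|k]]//= H1 H2; by [case: (PQ w H1 H2)|case: (PQ w H2 H1)].
- by apply: (@has_sum_weight n) => w [/PW|/QW].
- by move=> [_|[_|//]]; apply: (@has_sum_weight n).
Qed.

(** * Splitting walks at first and last visits *)

Variable v : posn.

Let Cset n := [set w | [/\ walks_from1 n w, vtx w n = v &
                 forall i, (i < n)%N -> vtx w i != v]].

(** The block [P k] collects the walks first at [v] at time [k]: a first passage of length [k]
    followed by any walk from [v] to [u]. *)
Lemma first_passage (u : posn) (t : nat -> R[i]) n :
  (forall m, has_sum (walks_between v u m) W (t m)) ->
  weight_of h [set w | [/\ walks_from1 n w, vtx w n = u &
    exists2 i, (i <= n)%N & vtx w i = v]] = cauchy_prod (C_ h v : nat -> R[i]) t n.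
Proof.
move=> ht; set D := [set w | _].
pose P k := [set w | D w /\ (k <= n)%N /\ vtx w k = v /\
  forall i, (i < k)%N -> vtx w i != v].
have PW k : P k `<=` walks_from1 n by move=> w [[]].
transitivity (\sum_(k < n.+1) weight_of h (P k)).
  apply: (@has_sum_partition _ _ n D P W (fun k => weight_of h (P k))) => [k _ w []//|w Dw|w j k||k _].
  - have [_ _ [i0 i0n wi0]] := Dw.
    have ex : exists i, (i <= n)%N && (vtx w i == v).
      by exists i0; rewrite i0n wi0 eqxx.
    case: (ex_minnP ex) => k /andP[kn /eqP wk] kmin; exists k => //.
    split=> //; split=> //; split=> // i ik; apply/negP => wi.
    by have := kmin i; rewrite wi (leq_trans (ltnW ik) kn) leqNgt ik => /(_ isT).
  - move=> [_ [_ [wj jmin]]] [_ [_ [wk kmin]]].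
    case: (ltngtP j k) => // jk; first by have := kmin _ jk; rewrite wj eqxx.
    by have := jmin _ jk; rewrite wk eqxx.
  - by apply: (@has_sum_weight n) => w [].
  - exact: has_sum_weight (@PW k).
apply: eq_bigr => k _; have kn : (k <= n)%N := leq_ord k.
apply: (@has_sum_concat k (n - k) (P k) (Cset k) (walks_between v u (n - k))).
- by move=> w [[[]]].
- by move=> w [[]].
- by move=> w1 w2 [_ -> _] [_ -> _].
- move=> w; rewrite subnKC//; split.
    move=> [[[wn w0] wu _] [_ [wk kmin]]].
    have [sw w1 w2] := (walk_split w kn).1 wn.
    split=> //; split=> //.
    + by split=> //; rewrite vtx_take.
    + by rewrite vtx_take.
    + by move=> i ik; rewrite vtx_take ?kmin// ltnW.
    + by rewrite vtx_drop addn0.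
    + by rewrite vtx_drop subnKC.
  move=> [sw [[w1 w0] wk kmin] [w2 _]]; rewrite vtx_drop subnKC// => wu.
  rewrite vtx_take// in w0; rewrite vtx_take// in wk.
  split; [split=> //|split=> //; split=> // i ik].
  + by split=> //; apply/(walk_split w kn).
  + by exists k.
  + by have := kmin i ik; rewrite vtx_take// ltnW.
- exact: has_sum_weight (@PW k).
- by apply: (@has_sum_weight k) => w [].
- exact: ht.
Qed.

(* Each first passage to [v] is split at its last visit to [1]. *)
Lemma last_exit : v != vertex1 ->
  (C_ h v : nat -> R[i]) = cauchy_prod (Bv_ h v : nat -> R[i]) (E_ h v).
Proof.
move=> v1; apply/funext => n.
pose P k := [set w | Cset n w /\ (k <= n)%N /\ vtx w k = vertex1 /\
  forall i, (k < i <= n)%N -> vtx w i != vertex1].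
have PW k : P k `<=` walks_from1 n by move=> w [[]].
transitivity (\sum_(k < n.+1) weight_of h (P k)).
  apply: (@has_sum_partition _ _ n (Cset n) P W (fun k => weight_of h (P k))) => [k _ w []//|w Dw|w j k||k _].
  - have [[_ w0] _ _] := Dw.
    have ex : exists i, (i <= n)%N && (vtx w i == vertex1).
      by exists 0%N; rewrite w0 eqxx.
    have ub i : (i <= n)%N && (vtx w i == vertex1) -> (i <= n)%N by case/andP.
    case: (ex_maxnP ex ub) => k /andP[kn /eqP wk] kmax; exists k => //.
    split=> //; split=> //; split=> // i /andP[ki ni]; apply/negP => wi.
    by have := kmax i; rewrite wi ni leqNgt ki => /(_ isT).
  - move=> [_ [jn [wj jmax]]] [_ [kn [wk kmax]]].
    case: (ltngtP j k) => // jk.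
      by have := jmax k; rewrite jk kn wk eqxx => /(_ isT).
    by have := kmax j; rewrite jk jn wj eqxx => /(_ isT).
  - by apply: (@has_sum_weight n) => w [].
  - exact: has_sum_weight (@PW k).
apply: eq_bigr => k _; have kn : (k <= n)%N := leq_ord k.
apply: (@has_sum_concat k (n - k) (P k)
  [set w | [/\ walks_from1 k w, vtx w k = vertex1 &
                 forall i, (i <= k)%N -> vtx w i != v]]
  [set w | [/\ walks_from1 (n - k) w, vtx w (n - k) = v &
     forall i, (0 < i < n - k)%N -> vtx w i != vertex1 /\ vtx w i != v]]).
- by move=> w [[[]]].
- by move=> w [[[]]].
- by move=> w1 w2 [_ -> _] [[_ ->] _ _].
- move=> w; rewrite subnKC//; split.
    move=> [[[wn w0] wv nv] [_ [wk kmax]]].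
    have [sw w1 w2] := (walk_split w kn).1 wn.
    (* At time [n] the walk is at [v], not at [1]. Thus all times up to [k] precede [n], and the
       prefix avoids [v] entirely. *)
    have kn' : (k < n)%N.
      rewrite ltn_neqAle kn andbT; apply: contra v1 => /eqP kn'.
      by rewrite -wv -kn' wk.
    split=> //; split.
    + by split=> //; rewrite vtx_take.
    + by rewrite vtx_take.
    + by move=> i ik; rewrite vtx_take ?nv// (leq_ltn_trans ik).
    + by split=> //; rewrite vtx_drop addn0.
    + by rewrite vtx_drop subnKC.
    + move=> i /andP[i0 ink]; have kin : (k + i < n)%N by rewrite -ltn_subRL.
      rewrite vtx_drop nv// kmax// -[X in (X < _)%N]addn0 ltn_add2l i0.
      by rewrite ltnW.
  move=> [sw [[w1 w0] wk nv] [[w2 _]]]; rewrite vtx_drop subnKC// => wv hE.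
  rewrite vtx_take// in w0; rewrite vtx_take// in wk.
  have E i : (k < i < n)%N -> vtx w i != vertex1 /\ vtx w i != v.
    move=> /andP[ki ni]; have := hE (i - k)%N.
    by rewrite vtx_drop (subnKC (ltnW ki)) subn_gt0 ki ltn_sub2r ?(ltn_trans ki)//; apply.
  split; [split=> //|split=> //; split=> // i /andP[ki]].
  + by split=> //; apply/(walk_split w kn).
  + move=> i ni; have [ik|ki] := leqP i k; first by have := nv i ik; rewrite vtx_take.
    by have [] := E i; rewrite ?ki.
  + rewrite leq_eqVlt => /orP[/eqP->|ni]; first by rewrite wv.
    by have [] := E i; rewrite ?ki.
- exact: has_sum_weight (@PW k).
- by apply: (@has_sum_weight k) => w [].
- by apply: (@has_sum_weight (n - k)) => w [].
Qed.

(** Edges are unordered, so reversal preserves weights. *)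
Lemma has_sum_rev a b n s :
  has_sum (walks_between a b n) W s -> has_sum (walks_between b a n) W s.
Proof.
have revP c d w : walks_between c d n w -> walks_between d c n (rev w).
  move=> [[sw ww] w0 wn].
  have vr i : (i <= n)%N -> vtx (rev w) i = vtx w (n - i).
    by move=> ni; rewrite /vtx nth_rev sw// subSS.
  split; [split; first by rewrite size_rev|by rewrite vr// subn0|by rewrite vr// subnn].
  move=> i ni; rewrite !vr ?(ltnW ni)// eq_sym.
  by have := ww (n - i.+1)%N; rewrite -subSn// subSS; apply; lia.
apply: (@has_sum_reindex _ _ _ rev).
- split=> [w|w w' _ _|w /revP wP]; first exact: revP.
    exact: (can_inj revK).
  by exists (rev w) => //; rewrite revK.
- by move=> w [[sw _] _ _]; rewrite (walk_weight_rev sw).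
Qed.

Lemma has_sum_map (f : posn -> posn) a b n s :
  bijective f -> (forall c d, c != d -> edge h (f c) (f d) = edge h c d) ->
  has_sum (walks_between a b n) W s ->
  has_sum (walks_between (f a) (f b) n) W s.
Proof.
move=> [g fK gK] hf.
have mapP (e : posn -> posn) c d w : injective e ->
    walks_between c d n w -> walks_between (e c) (e d) n (map e w).
  move=> e_inj [[sw ww] w0 wn].
  have ve i : (i <= n)%N -> vtx (map e w) i = e (vtx w i).
    by move=> ni; rewrite /vtx (nth_map vertex1) ?sw.
  split; [split; first by rewrite size_map|by rewrite ve// w0|by rewrite ve// wn].
  by move=> i ni; rewrite !ve ?(ltnW ni)// (inj_eq e_inj) ww.
apply: (@has_sum_reindex _ _ _ (map f)).
- split=> [w|w w' _ _|w /(mapP g _ _ _ (can_inj gK))]; first exact/mapP/can_inj/fK.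
    exact/inj_map/can_inj/fK.
  by rewrite !fK => wP; exists (map g w) => //; rewrite mapK.
- by move=> w [ww _ _]; rewrite (walk_weight_map hf ww).
Qed.

(* The last vertex of a walk of nonzero weight is reached, so that convexity
   applies there. *)
Lemma weight_of_extend n (P : set (seq posn)) : convex_light h ->
  P `<=` walks_from1 n ->
  weight_of h [set w | walks_from1 n.+1 w /\ P (take n.+1 w)] = weight_of h P.
Proof.
move=> [_ h_conv] PW; set D := [set w | _].
have DW : D `<=` walks_from1 n.+1 by move=> w [].
apply: (@has_sum_unique _ _ P W); last exact: has_sum_weight PW.
apply: (has_sum_fibers (p := take n.+1) _ (has_sum_weight DW)) => [w []//|y Py].
have [[sy wy] y0] := PW _ Py.
set F := _ `&` _; have FW : F `<=` walks_from1 n.+1 by move=> w [[]].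
(* The fibre over [y] consists of the one-step prolongations of [y], one for each vertex other than
   its last. *)
have FE w : F w -> w = rcons y (vtx w n.+1) /\ vtx w n.+1 != vtx y n.
  move=> [[[[sw ww] _] _] /= yw]; split.
    by rewrite -yw -take_nth ?sw// take_oversize// sw.
  by rewrite eq_sym -yw vtx_take// ww.
have FR x : x != vtx y n -> F (rcons y x).
  move=> xy; have tk : take n.+1 (rcons y x) = y by rewrite -cats1 -sy take_size_cat.
  have vr i : (i <= n)%N -> vtx (rcons y x) i = vtx y i.
    by move=> ni; rewrite /vtx nth_rcons sy ltnS ni.
  have vx : vtx (rcons y x) n.+1 = x by rewrite /vtx nth_rcons sy ltnn eqxx.
  split=> //; split; last by rewrite tk.
  split; last by rewrite vr.
  split; first by rewrite size_rcons sy.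
  move=> i; rewrite ltnS leq_eqVlt => /orP[/eqP->|ni].
    by rewrite vx vr// eq_sym.
  by rewrite !vr ?(ltnW ni)// wy.
have WF w : F w -> W w = W y * edge h (vtx y n) (vtx w n.+1).
  by move=> /FE[-> _]; rewrite (walk_weight_rcons _ sy) /vtx nth_rcons sy ltnn eqxx.
have [Wy0|Wy0] := eqVneq (W y) 0.
  rewrite Wy0; apply: eq_has_sum (@has_sum_zero R[i] _ F) => w Fw.
  by rewrite WF// Wy0 mul0r.
have yreach : reached h (vtx y n) by exists n, y.
pose N := [set x | x != vtx y n].
(* Convexity provides only the value of [sum_on]. Existence of the sum comes from lightness, on
   dividing the weights of the prolongations by [W y]. *)
have hN : has_sum N (fun x => edge h (vtx y n) x) 1.
  have : has_sum N (fun x => W y * edge h (vtx y n) x) (weight_of h F).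
    apply: (@has_sum_reindex _ _ _ (fun w => vtx w n.+1) F N W) => //; last first.
      exact: has_sum_weight FW.
    split=> [w /FE[]//|w w' /set_mem/FE[-> _] /set_mem/FE[-> _]|x /= Nx].
      by rewrite /vtx !nth_rcons sy ltnn eqxx => ->.
    exists (rcons y x); first exact: FR.
    by rewrite /vtx nth_rcons sy ltnn eqxx.
  move/(has_sumZ (W y)^-1) => hs.
  have {}hs : has_sum N (fun x => edge h (vtx y n) x) ((W y)^-1 * weight_of h F).
    by apply: eq_has_sum hs => x _; rewrite mulKf.
  by have := h_conv _ yreach; rewrite (sum_on_has_sum hs) => <-.
rewrite -[X in has_sum _ _ X]mulr1.
apply: (@has_sum_reindex _ _ _ (rcons y) N F (fun x => W y * edge h (vtx y n) x)).
- split=> [x /FR//|x x' _ _ /rcons_inj[]//|w Fw].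
  by have [wE xw] := FE w Fw; exists (vtx w n.+1).
- by move=> x _; rewrite (walk_weight_rcons _ sy).
- exact: has_sumZ.
Qed.

(** A walk of length [n + 1] visiting [v] either does so by time [n], contributing the previous
    total by [weight_of_extend], or first reaches [v] at its end. *)
Lemma visit_seq_series : v != vertex1 -> convex_light h ->
  visit_seq h v = (fun n => series (C_ h v) n.+1).
Proof.
move=> v1 h_conv; apply/funext; elim=> [|n IHn].
  rewrite seriesSr /series /= big_geq// add0r /visit_seq /C_.
  congr (weight_of h _); apply/seteqP; split=> w.
    move=> [[[sw ww] w0]]; case: w sw {ww} w0 => [|x [|]]//= _.
    by rewrite /vtx /= => ->; rewrite inE (negbTE v1).
  by move=> [[_ w0] wv _]; case/eqP: v1; rewrite -wv.
set V := [set w | walks_from1 n w /\ v \in w].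
have VW : V `<=` walks_from1 n by move=> w [].
rewrite seriesSr -IHn {1}/visit_seq /C_.
rewrite -[visit_seq h v n]/(weight_of h V) -(weight_of_extend h_conv VW).
rewrite -(@weight_ofU n.+1); [|by move=> w []|by move=> w []|]; last first.
  move=> w [[[sw _] _] [_ vt]] [_ _ nv]; have /(nthP vertex1)[j] := vt.
  rewrite size_take sw ltnSn => nj wj.
  by have := nv j nj; rewrite -(@vtx_take n)// /vtx wj eqxx.
congr (weight_of h _); apply/seteqP; split=> w; last first.
  move=> [[ww [_ /mem_take]]//|[ww wv _]]; split=> //.
  by rewrite -wv; apply/mem_nth; have [[-> _] _] := ww.
move=> [ww vw]; have [[sw wN] w0] := ww.
have [vt|vt] := boolP (v \in take n.+1 w).
  left; split=> //; split=> //; split; last by rewrite vtx_take.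
  by have [] := (walk_split w (leqnSn n)).1 (conj sw wN).
have nv i : (i < n.+1)%N -> vtx w i != v.
  move=> ni; apply: contra vt => /eqP <-; rewrite -(@vtx_take n)//.
  by rewrite mem_nth// size_take sw ltnSn.
right; split=> //; have /(nthP vertex1)[j] := vw; rewrite sw ltnS.
rewrite leq_eqVlt => /orP[/eqP->//|nj wj].
by have := nv j nj; rewrite /vtx wj eqxx.
Qed.

End Weights.

(** * Returns to 1 through [v] *)

Section ReturnDecomposition.
Variables (R : realType) (v : posn) (h : weight R).
Hypotheses (h_trans : transitive_at v h) (h_light : light h).

Lemma return_decomposition :
  (fun n => (B_ h n : R[i]) - Bv_ h v n) =
  cauchy_prod (cauchy_prod (C_ h v : nat -> R[i]) (B_ h)) (C_ h v).
Proof.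
have [f [f_bij f1 hf]] := h_trans.
pose g m := weight_of h (walks_between vertex1 v m).
have from1 a m : walks_between vertex1 a m `<=` walks_from1 m by move=> w [].
have BE m : B_ h m = weight_of h (walks_between vertex1 vertex1 m).
  by congr (weight_of h _); apply/seteqP; split=> w [] => [[]|].
(* The automorphism [f] carries closed walks at [1] to closed walks at [v]. *)
have hvv m : has_sum (walks_between v v m) (walk_weight h) (B_ h m).
  by rewrite BE -f1; apply: has_sum_map f_bij hf _; apply: has_sum_weight.
(* Reversal equates the walks from [v] to [1] with those from [1] to [v], which pass through [v] and
   so split again at their first visit. *)
have hv1 m : has_sum (walks_between v vertex1 m) (walk_weight h) (g m).
  by apply: has_sum_rev; apply: has_sum_weight.
have gE : g = cauchy_prod (C_ h v : nat -> R[i]) (B_ h).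
  apply/funext => n; rewrite -(first_passage h_light n hvv).
  congr (weight_of h _); apply/seteqP; split=> w; last by move=> [[]].
  by move=> [wn w0 wv]; split=> //; exists n.
rewrite cauchy_prodC -gE; apply/funext => n.
rewrite -(first_passage h_light n hv1); set P := [set w | _].
apply/eqP; rewrite subr_eq addrC; apply/eqP.
rewrite /Bv_ -(@weight_ofU _ _ h_light n).
- congr (weight_of h _); apply/seteqP; split=> w.
    move=> [ww w1]; have [[i ni wi]|nv] := pselect (exists2 i, (i <= n)%N & vtx w i = v).
      by right; split=> //; exists i.
    by left; split=> // i ni; apply/eqP => wi; apply: nv; exists i.
  by move=> [[? ? _]|[? ? _]].
- by move=> w [].
- by move=> w [].
- by move=> w [_ _ nv] [_ _ [i ni /eqP wi]]; have := nv i ni; rewrite wi.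
Qed.

End ReturnDecomposition.

(** * Evaluation at 1 and the limit *)

Unset Implicit Arguments.

Theorem mainTheorem12 (R : realType) (v : posn) (h : weight R)
    (v_neq1 : v != vertex1)
    (h_trans : transitive_at v h)
    (h_convex : convex_light h)
    (v_reached : reached h v)
    (E_ex : at1_exists (E_ h v))
    (C_ex : at1_exists (C_ h v))
    (Bv_ex : at1_exists (Bv_ h v))
    (B_ex : at1_exists (B_ h)) :
  cvgn (visit_seq h v) /\
  sqrt_set (1 - quot01 (at1 (Bv_ h v)) (at1 (B_ h))) (limn (visit_seq h v)) /\
  (at1 (B_ h) = 0 -> at1 (Bv_ h v) = 0 /\ limn (visit_seq h v) = 0).
Proof.
have h_light := h_convex.1.
have cvg_visit : visit_seq h v @ \oo --> at1 (C_ h v).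
  rewrite (visit_seq_series h_light v_neq1 h_convex).
  rewrite (@cvg_shiftS R[i]^o (series (C_ h v))); exact: C_ex.
have limv : limn (visit_seq h v) = at1 (C_ h v).
  exact: (cvg_lim (@norm_hausdorff _ R[i]^o) cvg_visit).
rewrite limv /sqrt_set /quot01 /=.
have eqB : at1 (B_ h) - at1 (Bv_ h v) = at1 (B_ h) * at1 (C_ h v) ^+ 2 :> R[i].
  exact: (lim_series_prod3 B_ex Bv_ex C_ex (return_decomposition h_trans h_light)).
have eqC : at1 (C_ h v) = at1 (Bv_ h v) * at1 (E_ h v) :> R[i].
  exact: (lim_series_prod2 Bv_ex E_ex C_ex (last_exit h_light v_neq1)).
split; first exact: cvg_visit.
move: eqB eqC; set b : R[i] := at1 (B_ h); set bv : R[i] := at1 (Bv_ h v).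
set c : R[i] := at1 (C_ h v); set e : R[i] := at1 (E_ h v) => eqB eqC.
(* For [b = 0] the identity [eqB] reads [- bv = 0]. *)
have b0_bv0 : b = 0 -> bv = 0.
  by move=> b0; apply/eqP; rewrite -oppr_eq0 -sub0r -b0 eqB b0 mul0r.
have bv0_c0 : bv = 0 -> c = 0 by rewrite eqC => ->; rewrite mul0r.
split; last by move=> /b0_bv0 bv0; split=> //; exact: bv0_c0.
have [b0|b0] := eqVneq b 0.
  by rewrite b0_bv0// bv0_c0 ?b0_bv0// eqxx subrr expr0n.
(* For [b] nonzero, the claim multiplied by [b] is [eqB]. *)
by rewrite andbF; apply: (mulfI b0); rewrite -eqB mulrBr mulr1 mulrCA divff// mulr1.
Qed.
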